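(* Let $f \in \mathscr{L}^1_{\flat}(\mathbb{R})$ and let $F$ be the convolution operator induced by $f$. Then \[\overline{F}_{\infty}(\phi) = \overline{P}(\phi)\] holds for every $\phi \in L^{\infty}(\mathbb{R})$.
   Context: All functions are real-valued. For $f \in L^1(\mathbb{R})$, $\hat{f}(\xi) = \int_{-\infty}^{\infty} f(x)e^{-i\xi x}dx$. $\mathscr{L}^1_{\flat}(\mathbb{R})$ is the set of $f \in L^1(\mathbb{R})$ with $f \ge 0$ and $\hat{f}(0) = 1$. The convolution operator induced by $f$ is $F : L^{\infty}(\mathbb{R}) \to L^{\infty}(\mathbb{R})$, $(F\phi)(x) = (f*\phi)(x) = \int_{-\infty}^{\infty}\phi(x-t)f(t)dt$. For $k \ge 1$ put $\overline{F}_k(\phi) = \limsup_{x \to \infty}(F^k\phi)(x)$; for $f \in \mathscr{L}^1_{\flat}(\mathbb{R})$ the sequence $\overline{F}_k(\phi)$ is non-increasing in $k$, and $\overline{F}_{\infty}(\phi) = \lim_{k \to \infty}\overline{F}_k(\phi)$. The functional $\overline{P}$ is \[\overline{P}(\phi) = \lim_{\theta \to \infty}\limsup_{x \to \infty}\frac{1}{\theta}\int_x^{x+\theta}\phi(t)dt, \quad \phi \in L^{\infty}(\mathbb{R}).\] *)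

(* Defs.v *)
From mathcomp Require Import all_boot all_order all_algebra.
From mathcomp Require Import complex.
From mathcomp Require Import all_classical all_reals all_analysis.
Import numFieldNormedType.Exports.

Set Implicit Arguments.
Unset Strict Implicit.
Unset Printing Implicit Defensive.

Import Order.TTheory GRing.Theory Num.Theory.
Local Open Scope classical_set_scope.
Local Open Scope ring_scope.

(* Elements of L^1 and L^oo are handled through representatives, i.e. everywhere
   defined measurable functions; nothing below depends on the representative,
   except the 0-th term [Fbar f phi 0], which does not affect the limit. *)
Definition Lone (R : realType) (f : R -> R) : Prop :=
  f \in Lfun (@lebesgue_measure R) 1%E.

Definition Linfty (R : realType) (phi : R -> R) : Prop :=
  phi \in Lfun (@lebesgue_measure R) +oo%E.

(* e^{- i xi x} = cos (xi x) - i sin (xi x), and the integral of a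
   complex-valued function is taken componentwise. *)
Definition fourier (R : realType) (f : R -> R) (xi : R) : R[i] :=
  Complex (\int[@lebesgue_measure R]_x (f x * cos (xi * x)))
          (- \int[@lebesgue_measure R]_x (f x * sin (xi * x))).

Definition Lflat (R : realType) (f : R -> R) : Prop :=
  [/\ Lone f,
      {ae @lebesgue_measure R, forall x, 0 <= f x} &
      fourier f 0 = 1].

Definition conv_op (R : realType) (f phi : R -> R) : R -> R :=
  fun x => \int[@lebesgue_measure R]_t (phi (x - t) * f t).

(* For k >= 1, [iter k (conv_op f) phi] is an everywhere defined bounded
   function, so the upper limit is the pointwise one; it is taken in \bar R. *)
Definition Fbar (R : realType) (f phi : R -> R) (k : nat) : \bar R :=
  limf_esup (fun x : R => (iter k (conv_op f) phi x)%:E) (pinfty_nbhs R).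

Definition Fbar_infty (R : realType) (f phi : R -> R) : \bar R :=
  lim (Fbar f phi k @[k --> \oo]).

Definition Pbar_at (R : realType) (phi : R -> R) (theta : R) : \bar R :=
  limf_esup (fun x : R =>
      (theta^-1 * \int[@lebesgue_measure R]_(t in `[x, x + theta]) phi t)%:E)
    (pinfty_nbhs R).

Definition Pbar (R : realType) (phi : R -> R) : \bar R :=
  lim (Pbar_at phi theta @[theta --> pinfty_nbhs R]).

(* Main.v *)
Require Import Defs.
From HB Require Import structures.
From mathcomp Require Import all_boot all_order all_algebra.
From mathcomp Require Import complex.
From mathcomp Require Import all_classical all_reals all_analysis.
From mathcomp Require Import measurable_realfun ess_sup_inf ring lra.
Import numFieldNormedType.Exports.

Set Implicit Arguments.
Unset Strict Implicit.
Unset Printing Implicit Defensive.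

Import Order.TTheory GRing.Theory Num.Theory.
Local Open Scope classical_set_scope.
Local Open Scope ring_scope.

(** Write [F] for convolution with the density [f], [T_s] for translation by [s]
    and [A_theta] for the average over [[x, x + theta]], which is convolution
    with [box theta] and hence commutes with [F].  Everything rests on
    [F^k (T_s phi - phi) -> 0] uniformly, for each [s].

    Let [N psi] be the limit of [sup |F^k psi|].  For small [s] the density [f]
    overlaps its translate by [s], so that [F = c G (1 + T_s) / 2 + (1 - c) H]
    with [c > 0] and sup-norm contractions [G], [H]; hence
    [N psi <= N (psi + T_s psi) / 2].  This inequality passes from [s] to [2s],
    so it holds for all [s], and applied to [psi = T_s phi - phi] it gives
    [N (T_s phi - phi) <= N (T_2s phi - phi) / 2 <= ... <= 2^(1-m) sup |phi|].

    Since [F phi] is uniformly continuous, [F^k phi - A_theta F^k phi -> 0]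
    uniformly, and [A_theta F^k phi = F^k A_theta phi] has upper limit at most
    that of [A_theta phi]; this bounds the limit of the [Fbar_k] by each
    [Pbar_at theta].  Conversely [F^k A_theta phi - A_theta phi -> 0] uniformly
    as [theta -> oo], so that [limsup_theta Pbar_at theta <= Fbar_k]. *)

Local Notation leb := lebesgue_measure.
Local Notation integr f := (lebesgue_measure.-integrable setT (EFin \o f)).

(** * Lebesgue measure and bounded measurable functions *)

Lemma integrable_measurable (R : realType) (u : R -> R) :
  integr u -> measurable_fun [set: R] u.
Proof. by move=> /measurable_int/measurable_EFinP. Qed.

Lemma integrD (R : realType) (u v : R -> R) :
  integr u -> integr v -> integr (fun t => u t + v t).
Proof. by move=> Iu Iv; exact: (integrableD measurableT Iu Iv). Qed.

Lemma integrB (R : realType) (u v : R -> R) :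
  integr u -> integr v -> integr (fun t => u t - v t).
Proof. by move=> Iu Iv; exact: (integrableB measurableT Iu Iv). Qed.

Lemma integrZ (R : realType) (k : R) (u : R -> R) :
  integr u -> integr (fun t => k * u t).
Proof.
move=> Iu; have /= := integrableZl measurableT k Iu.
by apply: eq_integrable => // x _; rewrite /= EFinM.
Qed.

(** One notion covers translations and reflections, so that each change of variables below is an
    instance of a single lemma. *)
Definition leb_preserving (R : realType) (T : R -> R) : Prop :=
  measurable_fun [set: R] T /\
  forall A : set R, measurable A -> @leb R (T @^-1` A) = @leb R A.

(** The pushforward agrees with Lebesgue measure on the intervals []b, c]], which determine it. *)
Lemma leb_preserving_shift (R : realType) (a : R) :
  leb_preserving (fun x : R => x + a).
Proof.
have ma : measurable_fun [set: R] (+%R^~ a : R -> measurableTypeR R).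
  exact: measurable_funD.
split=> // A mA.
pose mfa := isMeasurableFun.Build _ _ _ _ _ ma.
pose fa : {mfun R >-> measurableTypeR R} :=
  HB.pack (+%R^~ a : R -> measurableTypeR R) mfa.
apply/esym/(@lebesgue_measure_unique _
  (pushforward (@lebesgue_measure R) fa)) => //= _ [[b c]] _ <-.
rewrite /pushforward/=.
have -> : (fun x => x + a) @^-1` `]b, c]%classic = `]b - a, c - a]%classic.
  by apply/seteqP; split=> x /=; rewrite !in_itv/= ltrBlDr lerBrDr.
rewrite !lebesgue_measure_itv/= !lte_fin ltrD2r.
by rewrite -!EFinB opprB addrA subrK.
Qed.

Lemma leb_preserving_reflect (R : realType) (a : R) :
  leb_preserving (fun x : R => a - x).
Proof.
split; first exact: measurable_funB.
move=> A mA; have [mT sT] := leb_preserving_shift a.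
rewrite -(sT _ mA) -[RHS]lebesgue_measureN.
  congr (leb _); apply/seteqP; split=> x /=; by rewrite addrC.
by rewrite -[X in measurable X]setTI; exact: mT.
Qed.

Lemma leb_preserving_integrable (R : realType) (T f : R -> R) :
  leb_preserving T -> integr f -> integr (f \o T).
Proof.
move=> [mT sT] /integrableP[mf foo].
have mf' : measurable_fun setT f by exact/measurable_EFinP.
apply/integrableP; split.
  by apply/measurable_EFinP; exact: measurableT_comp.
have mnf : measurable_fun setT (fun x => `|f x|%:E).
  by apply/measurable_EFinP; exact: measurableT_comp.
have := @ge0_integral_pushforward _ _ (measurableTypeR R) (measurableTypeR R)
  R T mT (@leb R) setT (fun x => `|f x|%:E) measurableT mnf.
rewrite preimage_setT => E.
rewrite -[X in (X < _)%E]E; last by move=> y _; rewrite lee_fin.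
by rewrite (eq_measure_integral (@leb R))// => A mA _; exact: sT.
Qed.

Lemma leb_preserving_Rintegral (R : realType) (T f : R -> R) :
  leb_preserving T -> integr f ->
  \int[leb]_x f (T x) = \int[leb]_x f x.
Proof.
move=> pT If; have IfT := leb_preserving_integrable pT If.
case: pT => mT sT.
have := @integral_pushforward _ _ (measurableTypeR R) (measurableTypeR R)
  R T mT (@leb R) setT (EFin \o f) (measurable_int _ If).
rewrite preimage_setT => /(_ IfT measurableT) E.
rewrite /Rintegral -[X in fine X = _]E; congr fine.
by apply: eq_measure_integral => A mA _; exact: sT.
Qed.

Lemma leb_preserving_ae (R : realType) (T : R -> R) (P : R -> Prop) :
  leb_preserving T ->
  {ae @leb R, forall x, P x} -> {ae @leb R, forall x, P (T x)}.
Proof.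
move=> [mT sT] [N [mN N0 PN]]; exists (T @^-1` N); split.
- by rewrite -[X in measurable X]setTI; exact: mT.
- by rewrite -N0; exact: sT.
- by move=> x /= nP; exact: PN.
Qed.

(** * Bounded measurable functions and their integrals against integrable ones *)

(** The bound holds at every point, because the suprema and upper limits below are pointwise;
    [Linfty_bmeas] reduces essentially bounded functions to this case. *)
Definition bmeas (R : realType) (M : R) (psi : R -> R) : Prop :=
  measurable_fun [set: R] psi /\ forall x, `|psi x| <= M.

Lemma bmeas_ge0 (R : realType) (M : R) psi : bmeas M psi -> 0 <= M.
Proof. by move=> [_ /(_ 0)]; apply: le_trans. Qed.

Lemma bmeasD (R : realType) (M N : R) u v :
  bmeas M u -> bmeas N v -> bmeas (M + N) (fun x => u x + v x).
Proof.
move=> [mu bu] [mv bv]; split; first exact: measurable_funD.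
by move=> x; rewrite (le_trans (ler_normD _ _))// lerD.
Qed.

Lemma bmeasN (R : realType) (M : R) u :
  bmeas M u -> bmeas M (fun x => - u x).
Proof.
move=> [mu bu]; split; first exact: measurable_funN.
by move=> x; rewrite normrN.
Qed.

Lemma bmeas_comp (R : realType) (M : R) (T u : R -> R) :
  measurable_fun [set: R] T -> bmeas M u -> bmeas M (fun x => u (T x)).
Proof. by move=> mT [mu bu]; split=> // ; exact: measurableT_comp. Qed.

Lemma bmeas_shift (R : realType) (M : R) u s :
  bmeas M u -> bmeas M (fun x => u (x + s)).
Proof. by apply: bmeas_comp; exact: measurable_funD. Qed.

Lemma bmeas_reflect (R : realType) (M : R) u s :
  bmeas M u -> bmeas M (fun x => u (s - x)).
Proof. by apply: bmeas_comp; exact: measurable_funB. Qed.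

Lemma integrable_bmeasM (R : realType) (M : R) (u g : R -> R) :
  bmeas M u -> integr g -> integr (fun t => u t * g t).
Proof.
move=> [mu bu] Ig.
have := @integrableMr _ (measurableTypeR R) R (@leb R) setT
  measurableT u (EFin \o g) mu _ Ig.
apply; exists M; split; rewrite ?num_real// => x Mx t _.
by apply: le_trans (ltW Mx); exact: bu.
Qed.

Lemma norm_Rintegral_bmeasM (R : realType) (M : R) (u g : R -> R) :
  bmeas M u -> integr g ->
  `|\int[leb]_t (u t * g t)| <= M * \int[leb]_t `|g t|.
Proof.
move=> bu Ig; have Iug := integrable_bmeasM bu Ig.
rewrite (le_trans (le_normr_Rintegral measurableT Iug))//.
rewrite -RintegralZl//; last exact: integrable_norm.
apply: le_Rintegral => //; first exact: integrable_norm.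
- exact: integrZ (integrable_norm Ig).
- by move=> x _; rewrite normrM ler_wpM2r//; case: bu.
Qed.

Lemma integrable_translate_reflect (R : realType) (M : R) (psi g : R -> R) x :
  bmeas M psi -> integr g -> integr (fun t => psi (x - t) * g t).
Proof. by move=> /(bmeas_reflect x); exact: integrable_bmeasM. Qed.

(** * Continuity of translation in L^1 *)

(** Dominated convergence with limit zero, for real integrals and an explicit tolerance. *)
Lemma Rintegral_cvg0 (R : realType) (g : nat -> R -> R) (G : R -> R) :
  integr G -> (forall n, measurable_fun [set: R] (g n)) ->
  (forall n x, `|g n x| <= G x) ->
  (forall x, g n x @[n --> \oo] --> 0) ->
  forall e : R, 0 < e -> \forall n \near \oo, \int[leb]_x `|g n x| <= e.
Proof.
move=> IG mg gG g0 e e0.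
have mg' n : measurable_fun setT (EFin \o g n) by exact/measurable_EFinP.
have g0' x : [set: R] x -> (g n x)%:E @[n --> \oo] --> 0%E.
  by move=> _; apply: cvg_EFin; [exact: nearW|exact: g0].
have D := @dominated_convergence _ (measurableTypeR R) R (@leb R)
  setT measurableT (fun n x => (g n x)%:E) (cst 0%E) (EFin \o G) mg'
  (measurable_cst _).
have [|//||] := D.
- by apply: aeW; exact: g0'.
- by apply: aeW => x n _ /=; rewrite lee_fin.
move=> _ /fine_cvg/= + _.
move/cvgr0Pnorm_le => /(_ e e0); apply: filterS => n.
rewrite /=; under eq_integral do rewrite subr0.
by apply: le_trans; exact: ler_norm.
Qed.

Lemma L1_translation_compact (R : realType) (g : R -> R) (n : R) :
  continuous g -> (forall x, n < `|x| -> g x = 0) ->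
  forall e : R, 0 < e -> exists2 d : R, 0 < d &
    forall s, `|s| < d -> \int[leb]_t `|g (t + s) - g t| <= e.
Proof.
move=> cg g0 e e0.
have mg : measurable_fun [set: R] g by exact: continuous_measurable_fun.
have [M M0 gM] : exists2 M : R, 0 <= M & forall x, `|g x| <= M.
  have := compact_bounded (continuous_compact (continuous_subspaceT cg)
    (@segment_compact _ (- n) n)).
  move=> [M0 [_ /(_ (`|M0| + 1))]]; rewrite (le_lt_trans (ler_norm _)) ?ltrDl//.
  move=> /(_ isT) bM; exists (`|M0| + 1) => [|x]; first by rewrite addr_ge0.
  have [nx|xn] := ltP n `|x|; first by rewrite g0// normr0 addr_ge0.
  by apply: bM => /=; exists x => //; rewrite /= in_itv/= -ler_norml.
pose S (s : R) := \int[leb]_t `|g (t + s) - g t|.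
suff /cvgr0Pnorm_lt/(_ e e0)/nbhs_ballP[d /= d0 dS] : S s @[s --> (0 : R)] --> (0 : R).
  exists d => // s sd; apply/ltW; rewrite (le_lt_trans (ler_norm _))//.
  by apply: dS; rewrite /ball/= sub0r normrN.
(* Continuity at 0 is tested along sequences, to which dominated convergence applies. *)
suff H (u : nat -> R) :
    u k @[k --> \oo] --> (0 : R) -> S (u k) @[k --> \oo] --> (0 : R).
  by apply/(@cvg_nbhsP R R^o S 0 0) => u; exact: H.
move=> u0; apply/cvgr0Pnorm_le => {}e {}e0.
have [B0 [_ /(_ (`|B0| + 1))]] := cvg_seq_bounded (cvgP _ u0).
rewrite (le_lt_trans (ler_norm _)) ?ltrDl// => /(_ isT).
set B : R := `|B0| + 1 => uB.
(* As [B] bounds the shifts [u k], both [g] and its translates vanish outside this segment. *)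
pose G := fun x : R => M *+ 2 * \1_(`[- (n + B), n + B]) x.
have IG : integr G.
  exact: (integrZ (M *+ 2)
    (integrable_indic_itv (- (n + B)) (n + B) true false)).
have mgu k : measurable_fun [set: R] (fun t : R => g (t + u k) - g t).
  by apply: measurable_funB => //; apply: measurableT_comp => //;
    exact: measurable_funD.
suff : \forall k \near \oo, \int[leb]_x `|g (x + u k) - g x| <= e.
  by apply: filterS => k; rewrite ger0_norm//; exact: Rintegral_ge0.
apply: (Rintegral_cvg0 IG mgu _ _ e0).
- move=> k x; rewrite /G indicE.
  have [xn|xn] := leP `|x| (n + B).
    rewrite mem_set/= ?in_itv/= -?ler_norml// mulr1 mulr2n.
    by rewrite (le_trans (ler_normB _ _))// lerD.
  have uk := uB k I.
  have h : n < `|x + u k| by have := lerB_normD x (u k); move: xn uk => /=; lra.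
  have h' : n < `|x| by move: xn uk; have := normr_ge0 (u k) => /=; lra.
  by rewrite !g0// subrr normr0 mulr_ge0 ?mulrn_wge0.
- move=> x.
  rewrite -(subrr (g x)); apply: cvgB; last exact: cvg_cst.
  apply: (@cvg_comp _ _ _ (fun k => x + u k) g _ (nbhs x)) => //.
    by rewrite -[in nbhs x](addr0 x); apply: cvgD => //; exact: cvg_cst.
  exact: cg.
Qed.

(** On a large segment [f] is approximated in L^1 by a continuous [h m]; the product of [h m] with a
    continuous cutoff has compact support. *)
Lemma L1_approx_compact (R : realType) (f : R -> R) (e : R) :
  integr f -> 0 < e -> exists g : R -> R, [/\ continuous g,
    exists n : R, forall x, n < `|x| -> g x = 0, integr g &
    \int[leb]_x `|f x - g x| <= e].
Proof.
(* The cutoff is 1 for [|x| <= k - 1], is 0 for [|x| >= k] and is linear in [|x|] between. *)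
move=> If e0; pose chi (k : nat) (x : R) := Num.max 0 (Num.min 1 (k%:R - `|x|)).
have cchi k : continuous (chi k).
  move=> x; apply: (@continuous_max _ _ (cst 0) (fun y => Num.min 1 (k%:R - `|y|))).
    exact: cvg_cst.
  apply: (@continuous_min _ _ (cst 1) (fun y => k%:R - `|y|)).
    exact: cvg_cst.
  by apply: cvgB; [exact: cvg_cst|exact: norm_continuous].
have chi01 k x : 0 <= chi k x <= 1.
  by rewrite /chi le_max lexx/= ge_max ler01 ge_min lexx.
have chi0 k x : k%:R < `|x| -> chi k x = 0.
  move=> kx; rewrite /chi max_l// ge_min; apply/orP; right.
  by rewrite subr_le0 ltW.
have mchi k : measurable_fun [set: R] (chi k).
  exact: continuous_measurable_fun.
have mf : measurable_fun [set: R] f by exact: integrable_measurable.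
have e20 : 0 < e / 2 by rewrite divr_gt0.
have := @Rintegral_cvg0 _ (fun k x => f x * (1 - chi k x)) _ (integrable_norm If)
  _ _ _ _ e20.
case.
- by move=> k; apply: measurable_funM => //; exact: measurable_funB.
- move=> k x /=; rewrite normrM ler_piMr// ler_norml.
  by have /andP[] := chi01 k x; lra.
- move=> x; apply/cvgr0Pnorm_le => d d0; near=> k.
  suff -> : chi k x = 1 by rewrite subrr mulr0 normr0 ltW.
  rewrite /chi min_l ?max_r// lerBrDr.
  by near: k; exact: nbhs_infty_ger.
move=> k _ /(_ k (leqnn k))/= fk.
pose E : set R := `[- k%:R, k%:R]%classic.
have mE : measurable E by exact: measurable_itv.
have IEf : leb.-integrable E (EFin \o f).
  by apply: (@integrableS _ _ _ _ setT) => //.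
have Efin : (@leb R E < +oo)%E.
  by rewrite lebesgue_measure_itv/=; case: ifPn => // _; rewrite -EFinB ltry.
have [h [ch Ih]] := approximation_continuous_integrable mE Efin IEf.
move=> /fine_cvg/cvgr0Pnorm_le/(_ _ e20)[m _ /(_ m (leqnn m))/= hm].
have Ihm : integr (h m \_ E).
  have /integrable_mkcond := Ih m; move=> /(_ mE).
  by rewrite restrict_EFin.
have gE x : h m x * chi k x = chi k x * (h m \_ E) x.
  rewrite patchE; case: ifPn => [_|xE]; first by rewrite mulrC.
  rewrite chi0 ?mulr0 ?mul0r// ltNge; apply: contra xE => xk.
  by apply/mem_set; rewrite /E/= in_itv/= -ler_norml.
have Ig : integr (fun x => h m x * chi k x).
  have : integr (fun x => chi k x * (h m \_ E) x).
    apply: (@integrable_bmeasM _ 1) => //; split=> // x.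
    by rewrite ler_norml; have /andP[] := chi01 k x; lra.
  by apply: eq_integrable => // x _ /=; rewrite gE.
exists (fun x => h m x * chi k x); split => //.
- by move=> x; apply: cvgM; [exact: ch|exact: cchi].
- by exists k%:R => x kx; rewrite chi0// mulr0.
have Ifchi : integr (fun x => f x * (1 - chi k x)).
  have : integr (fun x => (1 - chi k x) * f x).
    apply: (@integrable_bmeasM _ 1) => //; split; first exact: measurable_funB.
    by move=> x; rewrite ler_norml; have /andP[] := chi01 k x; lra.
  by apply: eq_integrable => // x _ /=; rewrite mulrC.
have Ifh : integr ((fun x => f x - h m x) \_ E).
  have IEfh : leb.-integrable E (EFin \o (fun x => f x - h m x)).
    by apply: (integrableB _ IEf (Ih m)).
  by have /integrable_mkcond := IEfh; move=> /(_ mE); rewrite restrict_EFin.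
have -> : e = e / 2 + e / 2 by lra.
apply: le_trans (lerD fk (le_trans (ler_norm _) hm)).
have -> : fine (\int[leb]_(x in E) `|f x - h m x|%:E)%E =
    \int[leb]_x `|((fun x => f x - h m x) \_ E) x|.
  rewrite -[LHS]/(\int[leb]_(x in E) `|f x - h m x|) Rintegral_mkcond.
  by congr fine; apply: eq_integral => x _;
    rewrite /= !patchE; case: ifPn; rewrite ?normr0.
rewrite -RintegralD//; [|exact: integrable_norm|exact: integrable_norm].
apply: le_Rintegral => //.
- exact: (integrable_norm (integrB If Ig)).
- exact: (integrD (integrable_norm Ifchi) (integrable_norm Ifh)).
(* The first term is the tail of [f], the second the approximation error on [E]; each has L^1 norm
   at most [e / 2]. *)
move=> x _; have -> : f x - h m x * chi k x =
  f x * (1 - chi k x) + chi k x * ((fun x => f x - h m x) \_ E) x.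
  rewrite patchE; case: ifPn => [_|xE]; first by ring.
  rewrite chi0; first by ring.
  rewrite ltNge; apply: contra xE => xk.
  by apply/mem_set; rewrite /E/= in_itv/= -ler_norml.
rewrite (le_trans (ler_normD _ _))// lerD2l normrM ler_piMl//.
by rewrite ler_norml; have /andP[] := chi01 k x; lra.
Unshelve. all: by end_near. Qed.

(** Replacing [f] by a continuous compactly supported [g] costs [e / 3] twice, since by invariance
    the translates of [f] and [g] are as close as [f] and [g]. *)
Lemma L1_translation (R : realType) (f : R -> R) (e : R) :
  integr f -> 0 < e -> exists2 d : R, 0 < d &
    forall s, `|s| < d -> \int[leb]_t `|f (t + s) - f t| <= e.
Proof.
move=> If e0; have e30 : 0 < e / 3 by rewrite divr_gt0.
have [g [cg [n gn] Ig fg]] := L1_approx_compact If e30.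
have [d d0 gd] := L1_translation_compact cg gn e30.
exists d => // s sd.
have Ish (u : R -> R) : integr u -> integr (fun t => u (t + s)).
  by move=> Iu; exact: (leb_preserving_integrable (leb_preserving_shift s) Iu).
have IB (u v : R -> R) : integr u -> integr v -> integr (fun t => `|u t - v t|).
  by move=> Iu Iv; exact: (integrable_norm (integrB Iu Iv)).
have -> : e = e / 3 + (e / 3 + e / 3) by lra.
apply: le_trans (lerD fg (lerD (gd _ sd) fg)).
rewrite -{1}(leb_preserving_Rintegral (leb_preserving_shift s) (IB _ _ If Ig)).
have I1 := IB _ _ (Ish _ If) (Ish _ Ig).
have I2 := IB _ _ (Ish _ Ig) Ig.
have I3 := IB _ _ If Ig.
rewrite -RintegralD// -RintegralD//; last exact: integrD.
apply: le_Rintegral => //; [exact: IB (Ish _ If) If|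
  by apply: integrD => //; exact: integrD|].
move=> t _; have -> : f (t + s) - f t =
  (f (t + s) - g (t + s)) + ((g (t + s) - g t) + (g t - f t)) by lra.
rewrite (le_trans (ler_normD _ _))// lerD2l (le_trans (ler_normD _ _))//.
by rewrite lerD2l distrC.
Qed.

(** * The convolution operator *)

(** Substituting [t + s] for [t] moves the translation from [psi] onto the kernel [f]. *)
Lemma conv_op_shift_diff (R : realType) (M : R) (f psi : R -> R) (x s : R) :
  integr f -> bmeas M psi ->
  `|conv_op f psi (x + s) - conv_op f psi x| <=
    M * \int[leb]_t `|f (t + s) - f t|.
Proof.
move=> If bpsi; rewrite /conv_op.
have I1 := integrable_translate_reflect (x + s) bpsi If.
have I2 := integrable_translate_reflect x bpsi If.
have Ifs := leb_preserving_integrable (leb_preserving_shift s) If.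
have I3 := integrable_translate_reflect x bpsi Ifs.
rewrite -[X in X - _](leb_preserving_Rintegral (leb_preserving_shift s) I1).
have -> : \int[leb]_t (psi (x + s - (t + s)) * f (t + s)) =
    \int[leb]_t (psi (x - t) * f (t + s)).
  by congr fine; apply: eq_integral => t _; rewrite opprD addrACA subrr addr0.
rewrite -RintegralB//.
have -> : \int[leb]_t (psi (x - t) * f (t + s) - psi (x - t) * f t) =
    \int[leb]_t (psi (x - t) * (f (t + s) - f t)).
  by congr fine; apply: eq_integral => t _; rewrite mulrBr.
by apply: norm_Rintegral_bmeasM; [exact: bmeas_reflect|exact: integrB].
Qed.

Lemma conv_op_unif_continuous (R : realType) (M e : R) (f psi : R -> R) :
  integr f -> bmeas M psi -> 0 < e ->
  exists2 d : R, 0 < d & forall x s, `|s| < d ->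
    `|conv_op f psi (x + s) - conv_op f psi x| <= e.
Proof.
move=> If bpsi e0; have M0 := bmeas_ge0 bpsi.
have M1 : 0 < M + 1 by rewrite ltr_wpDl.
have [d d0 fd] := L1_translation If (divr_gt0 e0 M1).
exists d => // x s sd; apply: le_trans (conv_op_shift_diff x s If bpsi) _.
rewrite (le_trans (ler_wpM2l M0 (fd _ sd)))// mulrCA ler_piMr ?(ltW e0)//.
by rewrite ler_pdivrMr// mul1r lerDl.
Qed.

Lemma conv_op_measurable (R : realType) (M : R) (f psi : R -> R) :
  integr f -> bmeas M psi -> measurable_fun [set: R] (conv_op f psi).
Proof.
move=> If bpsi; apply: continuous_measurable_fun => x.
apply/cvgrPdist_le => e e0.
have [d d0 fd] := conv_op_unif_continuous If bpsi e0.
near=> y; rewrite distrC.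
have -> : y = x + (y - x) by rewrite addrC subrK.
apply: fd; near: y; apply/nbhs_ballP; exists d => //= y.
by rewrite /ball/= distrC.
Unshelve. all: by end_near. Qed.

Lemma bmeas_conv_op (R : realType) (M : R) (f psi : R -> R) :
  integr f -> bmeas M psi -> bmeas (M * \int[leb]_t `|f t|) (conv_op f psi).
Proof.
move=> If bpsi; split; first exact: (conv_op_measurable If bpsi).
by move=> x; apply: norm_Rintegral_bmeasM => //; exact: bmeas_reflect.
Qed.

Lemma conv_opD (R : realType) (M N : R) (f u v : R -> R) :
  integr f -> bmeas M u -> bmeas N v ->
  conv_op f (fun x => u x + v x) = fun x => conv_op f u x + conv_op f v x.
Proof.
move=> If bu bv; apply/funext => x; rewrite /conv_op -RintegralD//.
- by congr fine; apply: eq_integral => t _; rewrite mulrDl.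
- exact: (integrable_translate_reflect x bu If).
- exact: (integrable_translate_reflect x bv If).
Qed.

Lemma conv_opN (R : realType) (M : R) (f u : R -> R) :
  integr f -> bmeas M u -> conv_op f (fun x => - u x) = fun x => - conv_op f u x.
Proof.
move=> If bu; apply/funext => x; rewrite /conv_op -mulN1r -RintegralZl//.
- by congr fine; apply: eq_integral => t _; rewrite mulNr mulN1r.
- exact: (integrable_translate_reflect x bu If).
Qed.

Lemma conv_op_shift (R : realType) (f u : R -> R) (s : R) :
  conv_op f (fun x => u (x + s)) = fun x => conv_op f u (x + s).
Proof.
apply/funext => x; congr fine; apply: eq_integral => t _.
by rewrite addrAC.
Qed.

(** Fubini for [psi (x - s - t) * g t * f s], which is integrable since its inner absolute integral
    is at most [M * |f s|] times the L^1 norm of [g]. *)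
Lemma conv_op_comm (R : realType) (M : R) (f g psi : R -> R) :
  integr f -> integr g -> bmeas M psi ->
  conv_op f (conv_op g psi) = conv_op g (conv_op f psi).
Proof.
move=> If Ig [mpsi bpsi]; apply/funext => x.
have mf := integrable_measurable If; have mg := integrable_measurable Ig.
have M0 : 0 <= M by rewrite (le_trans _ (bpsi 0)).
pose H := fun z : R * R => (psi (x - z.1 - z.2) * g z.2 * f z.1)%:E.
have mH : measurable_fun [set: R * R] H.
  apply/measurable_EFinP; apply: measurable_funM; last first.
    exact: measurableT_comp.
  apply: measurable_funM; last exact: measurableT_comp.
  apply: measurableT_comp => //.
  by apply: measurable_funB => //; exact: measurable_funB.
have inner (u : R -> R) (y c : R) : integr u ->
    (\int[@leb R]_t (psi (y - t) * u t * c)%:E)%E = (conv_op u psi y * c)%:E.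
  move=> Iu.
  have I1 := integrable_translate_reflect y (conj mpsi bpsi : bmeas M psi) Iu.
  have I2 : integr (fun t => psi (y - t) * u t * c).
    have := integrZ c I1.
    by apply: eq_integrable => // t _ /=; rewrite mulrC.
  rewrite -[LHS]fineK; last exact: (integrable_fin_num measurableT I2).
  by congr EFin; exact: (RintegralZr c measurableT I1).
have IH : ((@leb R \x @leb R)%E).-integrable setT H.
  apply/integrable12ltyP => //.
  apply: (@le_lt_trans _ _ (\int[@leb R]_s
     ((M * \int[@leb R]_t `|g t|)%:E * `|f s|%:E))%E).
    apply: ge0_le_integral => //.
    - by move=> s _; exact: integral_ge0.
    - apply: (@measurable_fun_fubini_tonelli_F _ _ _ _ _ (@leb R) (abse \o H)) => //=.
      exact: measurableT_comp.
    - by apply/measurable_EFinP; apply: measurable_funM => //;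
        exact: measurableT_comp.
    move=> s _; rewrite /H/=.
    have Is := integrable_translate_reflect (x - s) (conj mpsi bpsi : bmeas M psi) Ig.
    have Is' : integr (fun t => psi (x - s - t) * g t * f s).
      have := integrZ (f s) Is.
      by apply: eq_integrable => // t _ /=; rewrite mulrC.
    have Ins := integrable_norm Is'.
    rewrite -[leLHS]fineK; last exact: (integrable_fin_num measurableT Ins).
    rewrite -EFinM lee_fin mulrAC -RintegralZl//; last exact: integrable_norm.
    apply: (le_Rintegral measurableT Ins).
      exact: integrZ (integrable_norm Ig).
    move=> t _ /=; rewrite !normrM mulrAC ler_wpM2r//.
    by rewrite ler_wpM2r.
  rewrite integralZl//; last exact: integrable_norm.
  rewrite lte_mul_pinfty ?lee_fin ?mulr_ge0 ?Rintegral_ge0//.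
  by have /integrableP[_ ] := If.
have := Fubini IH; rewrite /H/=.
under eq_integral do rewrite inner//.
(* Writing [x - s - t] as [x - t - s] turns the swapped integral into the other composition. *)
under [in X in _ = X -> _]eq_integral => t _.
  under eq_integral do rewrite (addrAC x) mulrAC.
  rewrite inner//; over.
by move=> E; rewrite /conv_op /Rintegral E.
Qed.

(** * Asymptotic invariance of the iterates under translation *)

(** Nonnegativity is required everywhere; [Lflat_density] provides such a representative. *)
Definition density (R : realType) (f : R -> R) : Prop :=
  [/\ integr f, forall x, 0 <= f x & \int[leb]_x f x = 1].

Lemma Rintegral_norm_density (R : realType) (f : R -> R) :
  density f -> \int[leb]_x `|f x| = 1.
Proof.
move=> [_ f0 <-]; congr fine; apply: eq_integral => x _.
by rewrite ger0_norm.
Qed.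

(** Convolution with a density contracts the sup norm. *)
Lemma bmeas_iter (R : realType) (M : R) (f psi : R -> R) k :
  density f -> bmeas M psi -> bmeas M (iter k (conv_op f) psi).
Proof.
move=> df bpsi; elim: k => // k IH; rewrite iterS.
have [If _ _] := df; have := bmeas_conv_op If IH.
by rewrite Rintegral_norm_density// mulr1.
Qed.

Lemma iter_conv_opD (R : realType) (M N : R) (f u v : R -> R) k :
  density f -> bmeas M u -> bmeas N v ->
  iter k (conv_op f) (fun x => u x + v x) =
  fun x => iter k (conv_op f) u x + iter k (conv_op f) v x.
Proof.
move=> df bu bv; elim: k => // k IH; rewrite !iterS IH.
have [If _ _] := df.
exact: (conv_opD If (bmeas_iter k df bu) (bmeas_iter k df bv)).
Qed.

Lemma iter_conv_opN (R : realType) (M : R) (f u : R -> R) k :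
  density f -> bmeas M u ->
  iter k (conv_op f) (fun x => - u x) = fun x => - iter k (conv_op f) u x.
Proof.
move=> df bu; elim: k => // k IH; rewrite !iterS IH.
by have [If _ _] := df; exact: (conv_opN If (bmeas_iter k df bu)).
Qed.

Lemma iter_conv_op_shift (R : realType) (f u : R -> R) (s : R) k :
  iter k (conv_op f) (fun x => u (x + s)) =
  fun x => iter k (conv_op f) u (x + s).
Proof. by elim: k => // k IH; rewrite !iterS IH conv_op_shift. Qed.

Lemma iter_conv_op_comm (R : realType) (M : R) (f g psi : R -> R) k :
  density f -> integr g -> bmeas M psi ->
  conv_op g (iter k (conv_op f) psi) = iter k (conv_op f) (conv_op g psi).
Proof.
move=> df Ig bpsi; elim: k => // k IH; rewrite !iterS -IH.
by have [If _ _] := df; rewrite (conv_op_comm Ig If (bmeas_iter k df bpsi)).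
Qed.

(* The common part [h] of [f] and its translate splits [f] as
   [(h + h(. + s)) / 2 + r] with [r >= 0], i.e. [F = H (1 + T_s) / 2 + r * _];
   [c] is the mass of [h]. *)
Lemma conv_op_overlap (R : realType) (f : R -> R) :
  density f -> exists2 d : R, 0 < d & forall s : R, `|s| < d ->
    exists c : R, [/\ 0 < c, c <= 1 & forall A B psi,
      bmeas A (fun x => psi x + psi (x + s)) -> bmeas B psi ->
      forall x, `|conv_op f psi x| <= c * (A / 2) + (1 - c) * B].
Proof.
move=> df; have [If f0 f1] := df.
(* An L^1 distance at most 1 between two densities forces their common part to have mass at least
   1/2. *)
have [d d0 fd] := L1_translation If ltr01.
exists d => // s sd.
pose fs (t : R) := f (t - s).
have pms := leb_preserving_shift (- s); have ps := leb_preserving_shift s.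
have Ifs : integr fs := leb_preserving_integrable pms If.
have Ih0 := integrB (integrD If Ifs) (integrable_norm (integrB Ifs If)).
(* This is the pointwise minimum of [f] and [fs]. *)
pose h (t : R) := 2^-1 * (f t + fs t - `|fs t - f t|).
have Ih : integr h := integrZ 2^-1 Ih0.
have h0 t : 0 <= h t.
  rewrite mulr_ge0 ?invr_ge0// subr_ge0 (le_trans (ler_normB _ _))//.
  by rewrite !ger0_norm ?f0// addrC.
have hf t : h t <= f t.
  rewrite /h; have := ler_norm (fs t - f t); lra.
have hfs t : h (t + s) <= f t.
  rewrite /h /fs addrK; have := ler_norm (f (t + s) - f t).
  rewrite distrC; have := ler_norm (f (t + s) - f t); lra.
pose c := \int[leb]_t h t.
have c2 : 2^-1 <= c.
  rewrite /c RintegralZl// ler_pMr ?invr_gt0//.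
  rewrite RintegralB ?RintegralD//;
    [|exact: integrD|exact: integrable_norm (integrB Ifs If)].
  rewrite (leb_preserving_Rintegral pms If) f1 -addrA lerDl subr_ge0.
  by apply: fd; rewrite normrN.
have c1 : c <= 1 by rewrite -f1; apply: le_Rintegral.
exists c; split=> //; first by rewrite (lt_le_trans _ c2)// invr_gt0.
move=> A B psi bA bB x.
have Ihs : integr (fun t => h (t + s)) := leb_preserving_integrable ps Ih.
(* Both [h] and [h (. + s)] lie below [f], hence so does their mean, and the remainder has mass
   [1 - c]. *)
pose r (t : R) := f t - 2^-1 * (h t + h (t + s)).
have Ir : integr r := integrB If (integrZ 2^-1 (integrD Ih Ihs)).
have r0 t : 0 <= r t by rewrite /r; have := hf t; have := hfs t; lra.
have intr : \int[leb]_t `|r t| = 1 - c.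
  have -> : \int[leb]_t `|r t| = \int[leb]_t r t.
    by congr fine; apply: eq_integral => t _; rewrite ger0_norm.
  rewrite RintegralB//; last exact: integrZ (integrD Ih Ihs).
  rewrite RintegralZl//; last exact: integrD.
  rewrite RintegralD// (leb_preserving_Rintegral ps Ih) f1 -/c; lra.
have inth : \int[leb]_t `|h t| = c.
  by congr fine; apply: eq_integral => t _; rewrite ger0_norm.
have Ipr := integrable_translate_reflect x bB Ir.
have Iph := integrable_translate_reflect x bB Ih.
have Iphs := integrable_translate_reflect x bB Ihs.
have Ipsh := integrable_translate_reflect (x + s) bB Ih.
(* The translate of [h] acts on [psi] as [h] acts on the translate of [psi]. *)
have shE : \int[leb]_t (psi (x - t) * h (t + s)) =
    \int[leb]_t (psi (x + s - t) * h t).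
  rewrite -(leb_preserving_Rintegral ps Ipsh).
  by congr fine; apply: eq_integral => t _; rewrite opprD addrACA subrr addr0.
have -> : conv_op f psi x =
    2^-1 * \int[leb]_t ((psi (x - t) + psi (x - t + s)) * h t) +
    \int[leb]_t (psi (x - t) * r t).
  have -> : \int[leb]_t ((psi (x - t) + psi (x - t + s)) * h t) =
      \int[leb]_t (psi (x - t) * h t) + \int[leb]_t (psi (x - t) * h (t + s)).
    rewrite shE -RintegralD//; congr fine; apply: eq_integral => t _.
    by rewrite mulrDl (addrAC x).
  rewrite -RintegralD// -RintegralZl//; last exact: integrD.
  rewrite -RintegralD//; last exact: integrZ (integrD Iph Iphs).
  congr fine; apply: eq_integral => t _; congr EFin; rewrite /r; ring.
rewrite (le_trans (ler_normD _ _))// lerD//.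
  rewrite normrM ger0_norm ?invr_ge0//.
  have := norm_Rintegral_bmeasM (bmeas_reflect x bA) Ih.
  by rewrite inth => H; move: H; lra.
have := norm_Rintegral_bmeasM (bmeas_reflect x bB) Ir.
by rewrite intr mulrC.
Qed.

(** * The asymptotic seminorm and the halving inequality *)

(* The seminorm [lim_k sup |F^k psi|], the limit being an infimum because
   [F] is a contraction for the sup norm. *)
Definition asup (R : realType) (f psi : R -> R) : R :=
  inf [set b | exists k, forall x, `|iter k (conv_op f) psi x| <= b].

Lemma asup_le (R : realType) (f psi : R -> R) (b : R) k :
  (forall x, `|iter k (conv_op f) psi x| <= b) -> asup f psi <= b.
Proof.
move=> kb; apply: ge_inf; last by exists k.
by exists 0 => c [j /(_ 0)]; apply: le_trans.
Qed.

Lemma asup_ge0 (R : realType) (f psi : R -> R) : 0 <= asup f psi.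
Proof.
rewrite /asup; set S := (X in inf X).
(* If no iterate is bounded, the set is empty and its [inf] is 0 by convention. *)
have [->|/set0P S0] := eqVneq S set0; first by rewrite inf0.
by apply: lb_le_inf => // c [j /(_ 0)]; apply: le_trans.
Qed.

(** By contraction a bound reached at one index persists, so several bounds can be used at a common
    index. *)
Lemma asup_gt (R : realType) (M : R) (f psi : R -> R) (b : R) :
  density f -> bmeas M psi -> asup f psi < b ->
  exists k, forall j, (k <= j)%N -> bmeas b (iter j (conv_op f) psi).
Proof.
move=> df bpsi /inf_lt[].
  by exists M; exists 0%N; case: bpsi.
move=> c [k kc] cb; exists k => j kj; rewrite -(subnK kj) iterD.
apply: bmeas_iter => //; split; first by case: (bmeas_iter k df bpsi).
by move=> x; rewrite (le_trans (kc x))// ltW.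
Qed.

Lemma asupD (R : realType) (M N : R) (f u v : R -> R) :
  density f -> bmeas M u -> bmeas N v ->
  asup f (fun x => u x + v x) <= asup f u + asup f v.
Proof.
move=> df bu bv; apply/ler_addgt0Pr => e e0.
have e20 : 0 < e / 2 by rewrite divr_gt0.
have [k1 H1] : exists k, forall j, (k <= j)%N ->
    bmeas (asup f u + e / 2) (iter j (conv_op f) u).
  by apply: (asup_gt df bu); rewrite ltrDl.
have [k2 H2] : exists k, forall j, (k <= j)%N ->
    bmeas (asup f v + e / 2) (iter j (conv_op f) v).
  by apply: (asup_gt df bv); rewrite ltrDl.
apply: (@asup_le _ _ _ _ (maxn k1 k2)) => x.
rewrite (iter_conv_opD _ df bu bv) (le_trans (ler_normD _ _))//.
have -> : asup f u + asup f v + e = (asup f u + e / 2) + (asup f v + e / 2) by lra.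
by apply: lerD; [case: (H1 _ (leq_maxl k1 k2))|case: (H2 _ (leq_maxr k1 k2))].
Qed.

Lemma asup_shift (R : realType) (M : R) (f u : R -> R) (s : R) :
  density f -> bmeas M u -> asup f (fun x => u (x + s)) <= asup f u.
Proof.
move=> df bu; apply/ler_addgt0Pr => e e0.
have [k H] : exists k, forall j, (k <= j)%N ->
    bmeas (asup f u + e) (iter j (conv_op f) u).
  by apply: (asup_gt df bu); rewrite ltrDl.
apply: (@asup_le _ _ _ _ k) => x; rewrite iter_conv_op_shift.
by case: (H k (leqnn k)).
Qed.

(** Quantified over all bounded [psi], because the doubling step applies it also to
    [psi + T_s psi]. *)
Definition halving (R : realType) (f : R -> R) (s : R) : Prop :=
  forall M psi, bmeas M psi ->
    asup f psi <= asup f (fun x => psi x + psi (x + s)) / 2.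

(** The overlap estimate on late iterates gives [N psi <= c * N w / 2 + (1 - c) * N psi] in the
    limit, and [c > 0] cancels. *)
Lemma halving_small (R : realType) (f : R -> R) :
  density f -> exists2 d : R, 0 < d & forall s : R, `|s| < d -> halving f s.
Proof.
move=> df; have [d d0 H] := conv_op_overlap df; exists d => // s sd M psi bpsi.
have [c [c0 c1 {}H]] := H _ sd.
set w := fun x => psi x + psi (x + s).
have bw : bmeas (M + M) w by apply: bmeasD => //; exact: bmeas_shift.
rewrite -(ler_pM2l c0); apply/ler_addgt0Pr => e e0.
have [k1 H1] : exists k, forall j, (k <= j)%N ->
    bmeas (asup f psi + e) (iter j (conv_op f) psi).
  by apply: (asup_gt df bpsi); rewrite ltrDl.
have [k2 H2] : exists k, forall j, (k <= j)%N ->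
    bmeas (asup f w + e) (iter j (conv_op f) w).
  by apply: (asup_gt df bw); rewrite ltrDl.
have : asup f psi <= c * ((asup f w + e) / 2) + (1 - c) * (asup f psi + e).
  (* The overlap estimate consumes one further application of [F]. *)
  apply: (@asup_le _ _ _ _ (maxn k1 k2).+1) => x; rewrite iterS; apply: H.
    have := H2 _ (leq_maxr k1 k2);
    rewrite /w (iter_conv_opD _ df bpsi (bmeas_shift s bpsi)).
    by rewrite iter_conv_op_shift.
  exact: H1 _ (leq_maxl k1 k2).
have : 0 <= c * e by rewrite mulr_ge0 ?ltW.
by move: (asup f psi) (asup f w) => p q; lra.
Qed.

(** Two halvings give [N psi <= N (w + T_s w) / 4], where [w + T_s w = u + 2 T_s psi]; hence
    [4 N psi <= N u + 2 N psi]. *)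
Lemma halving_double (R : realType) (f : R -> R) (s : R) :
  density f -> halving f s -> halving f (s + s).
Proof.
move=> df Hs M psi bpsi.
set w := fun x => psi x + psi (x + s).
have bs := bmeas_shift s bpsi.
have bw : bmeas (M + M) w by exact: bmeasD.
have H1 := Hs _ _ bpsi; have H2 := Hs _ _ bw.
pose u x := psi x + psi (x + (s + s)).
have bu : bmeas (M + M) u by apply: bmeasD => //; exact: bmeas_shift.
have E : (fun x => w x + w (x + s)) =
    fun x => u x + (psi (x + s) + psi (x + s)).
  by apply/funext => x; rewrite /w /u (addrA x); ring.
move: H2; rewrite E => H2.
have H3 := asupD df bu (bmeasD bs bs).
have H4 := asupD df bs bs.
have H5 := asup_shift s df bpsi.
rewrite -/w in H1; rewrite -/u; move: H1 H2 H3 H4 H5; lra.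
Qed.

Lemma halving_all (R : realType) (f : R -> R) (s : R) :
  density f -> halving f s.
Proof.
move=> df; have [d d0 H] := halving_small df.
have dbl m : forall t : R, `|t| < d * 2 ^+ m -> halving f t.
  elim: m => [|m IH] t; first by rewrite expr0 mulr1; exact: H.
  move=> tm; have -> : t = t / 2 + t / 2 by lra.
  apply: halving_double => //; apply: IH.
  rewrite normrM (@ger0_norm _ 2^-1) ?invr_ge0// ltr_pdivrMr//.
  by rewrite -mulrA -exprSr.
(* This index [m] satisfies [|s| / d < m <= 2 ^ m]. *)
apply: (dbl (Num.truncn (`|s| / d)).+1).
rewrite mulrC -ltr_pdivrMr// (lt_le_trans (real_truncnS_gt (num_real _)))//.
by rewrite -natrX ler_nat ltnW// ltn_expl.
Qed.

(** For [u = T_t psi - psi] the sum [u + T_t u] telescopes to [T_2t psi - psi]. So doubling [t] at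
    least doubles the seminorm, which never exceeds [2 M]. *)
Lemma asup_diff_shift (R : realType) (M : R) (f psi : R -> R) (s : R) :
  density f -> bmeas M psi -> asup f (fun x => psi (x + s) - psi x) = 0.
Proof.
move=> df bpsi; have bd t := bmeasD (bmeas_shift t bpsi) (bmeasN bpsi).
have H m : forall t, asup f (fun x => psi (x + t) - psi x) * 2 ^+ m <= M + M.
  elim: m => [|m IH] t.
    rewrite expr0 mulr1; apply: (@asup_le _ _ _ _ 0%N) => x /=.
    by case: (bd t).
  rewrite exprS mulrA (le_trans _ (IH (t + t)))// ler_wpM2r ?exprn_ge0//.
  have := halving_all t df (bd t); rewrite ler_pdivlMr//.
  congr (_ <= asup f _); apply/funext => x.
  by rewrite (addrA x); ring.
apply/eqP; rewrite eq_le asup_ge0 andbT leNgt; apply/negP => a0.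
set a := asup _ _ in a0.
have := H (Num.truncn ((M + M) / a)).+1 s; rewrite -/a leNgt => /negP; apply.
rewrite mulrC -ltr_pdivrMr// (lt_le_trans (real_truncnS_gt (num_real _)))//.
by rewrite -natrX ler_nat ltnW// ltn_expl.
Qed.

Lemma iter_conv_op_shift_cvg (R : realType) (M e : R) (f psi : R -> R) (s : R) :
  density f -> bmeas M psi -> 0 < e -> exists k, forall j, (k <= j)%N ->
  forall x, `|iter j (conv_op f) psi (x + s) - iter j (conv_op f) psi x| <= e.
Proof.
move=> df bpsi e0.
have bs := bmeas_shift s bpsi; have bN := bmeasN bpsi.
have [] := @asup_gt _ _ f _ e df (bmeasD bs bN).
  by rewrite (asup_diff_shift _ df bpsi).
move=> k H; exists k => j kj x; have [_ /(_ x)] := H j kj.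
by rewrite (iter_conv_opD _ df bs bN) iter_conv_op_shift (iter_conv_opN _ df bpsi).
Qed.

(** * Averages over intervals *)

(** The support is [[- theta, 0]] because convolution reflects it: the average is then over
    [[x, x + theta]]. *)
Definition box (R : realType) (theta t : R) : R :=
  theta^-1 * \1_(`[- theta, 0]%classic : set R) t.

Lemma Rintegral_indic_itv (R : realType) (a b : R) : a <= b ->
  \int[leb]_t \1_(`[a, b]%classic : set R) t = b - a.
Proof.
move=> ab; rewrite /Rintegral integral_indic// setIT/= lebesgue_measure_itv/=.
rewrite lte_fin; case: ltP => //= ba.
by apply/eqP; rewrite eq_sym subr_eq0 eq_le ba ab.
Qed.

Lemma box_ge0 (R : realType) (theta t : R) : 0 < theta -> 0 <= box theta t.
Proof. by move=> th0; rewrite mulr_ge0// invr_ge0 ltW. Qed.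

Lemma integrable_box (R : realType) (theta : R) : integr (box theta).
Proof. exact: (integrZ theta^-1 (integrable_indic_itv (- theta) 0 true false)). Qed.

Lemma density_box (R : realType) (theta : R) : 0 < theta -> density (box theta).
Proof.
move=> th0; split; [exact: integrable_box|by move=> t; exact: box_ge0|].
rewrite RintegralZl//; last exact: (integrable_indic_itv (- theta) 0 true false).
by rewrite Rintegral_indic_itv ?oppr_le0 ?(ltW th0)// sub0r opprK mulVf ?gt_eqF.
Qed.

Lemma conv_op_boxE (R : realType) (M theta x : R) (psi : R -> R) :
  0 < theta -> bmeas M psi ->
  conv_op (box theta) psi x =
  theta^-1 * \int[leb]_(t in `[x, x + theta]) psi t.
Proof.
move=> th0 bpsi.
have I1 := integrable_translate_reflect x bpsi (integrable_box theta).
rewrite /conv_op -(leb_preserving_Rintegral (leb_preserving_reflect x) I1).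
rewrite [in RHS]Rintegral_mkcond -[RHS]RintegralZl//.
  congr fine; apply: eq_integral => t _; congr EFin.
  rewrite opprB addrCA subrr addr0 /box mulrCA; congr (_ * _).
  rewrite patchE indicE; have -> : (x - t \in (`[- theta, 0]%classic : set R)) =
     (t \in (`[x, x + theta]%classic : set R)).
    apply/idP/idP => /set_mem/=; rewrite in_itv/= => xt; apply/mem_set => /=;
    rewrite in_itv/=; lra.
  by case: ifPn => _; rewrite ?mulr1 ?mulr0.
have := integrable_bmeasM bpsi (integrable_indic_itv x (x + theta) true false).
apply: eq_integrable => // t _ /=; congr EFin.
by rewrite patchE indicE; case: ifPn => _; rewrite ?mulr1 ?mulr0.
Qed.

(** The box and its translate differ only within [|s|] of the endpoints [- theta] and 0, on two
    intervals of length [2 |s|]. *)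
Lemma box_shift_diff (R : realType) (theta s : R) : 0 < theta ->
  \int[leb]_t `|box theta (t + s) - box theta t| <= 4 * `|s| / theta.
Proof.
move=> th0; have ti0 : 0 <= theta^-1 by rewrite invr_ge0 ltW.
pose J (a : R) := fun t : R => \1_(`[a - `|s|, a + `|s|]%classic : set R) t : R.
have IJ a : integr (J a) := integrable_indic_itv (a - `|s|) (a + `|s|) true false.
have Ib := integrable_box theta.
have Ibs := leb_preserving_integrable (leb_preserving_shift s) Ib.
apply: (@le_trans _ _ (\int[leb]_t (theta^-1 * (J (- theta) t + J 0 t)))).
  apply: le_Rintegral => //.
  - exact: (integrable_norm (integrB Ibs Ib)).
  - exact: (integrZ theta^-1 (integrD (IJ _) (IJ _))).
  move=> t _; rewrite /box -mulrBr normrM (ger0_norm ti0) ler_wpM2l// /J !indicE.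
  have inE (a b y : R) : (y \in (`[a, b]%classic : set R)) = (a <= y <= b).
    by apply/idP/idP => [/set_mem/=|yab]; rewrite ?in_itv//;
      apply/mem_set; rewrite /= in_itv.
  have s1 := ler_norm s; have s2 : - s <= `|s| by rewrite -normrN ler_norm.
  rewrite !inE.
  case: (boolP (- theta <= t + s <= 0)) => h1; case: (boolP (- theta <= t <= 0)) => h2;
   rewrite ?subrr ?subr0 ?sub0r ?normr0 ?normrN ?normr1 ?addr_ge0//.
  - case: (boolP (- theta - `|s| <= t <= - theta + `|s|)) => h3; first by rewrite lerDl.
    case: (boolP (- `|s| <= t <= 0 + `|s|)) => h4; first by rewrite lerDr.
    exfalso; move: h1 h2 h3 h4; rewrite !negb_and -!ltNge.
    move=> /andP[? ?] /orP[] ? /orP[] ? /orP[] ?; lra.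
  - case: (boolP (- theta - `|s| <= t <= - theta + `|s|)) => h3; first by rewrite lerDl.
    case: (boolP (- `|s| <= t <= 0 + `|s|)) => h4; first by rewrite lerDr.
    exfalso; move: h2 h1 h3 h4; rewrite !negb_and -!ltNge.
    move=> /andP[? ?] /orP[] ? /orP[] ? /orP[] ?; lra.
have s0 := normr_ge0 s.
rewrite RintegralZl//; last exact: (integrD (IJ _) (IJ _)).
rewrite RintegralD// !Rintegral_indic_itv; [|lra|lra].
by rewrite mulrC ler_wpM2r//; lra.
Qed.

(** * Comparison of iterates with interval averages *)

Lemma conv_op_approx (R : realType) (M e a x : R) (f psi : R -> R) :
  density f -> bmeas M psi -> (forall t, f t != 0 -> `|psi (x - t) - a| <= e) ->
  0 <= e -> `|conv_op f psi x - a| <= e.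
Proof.
move=> df bpsi psia e0; have [If f0 f1] := df.
have Ip := integrable_translate_reflect x bpsi If.
have -> : a = \int[leb]_t (a * f t) by rewrite RintegralZl// f1 mulr1.
rewrite /conv_op -RintegralB//; last exact: integrZ.
have I1 : integr (fun t => psi (x - t) * f t - a * f t) := integrB Ip (integrZ a If).
apply: le_trans (le_normr_Rintegral measurableT I1) _.
have -> : e = \int[leb]_t (e * f t) by rewrite RintegralZl// f1 mulr1.
apply: le_Rintegral => //; [exact: integrable_norm I1|exact: integrZ|].
move=> t _; rewrite -mulrBl normrM (ger0_norm (f0 t)).
have [->|ft] := eqVneq (f t) 0; first by rewrite !mulr0.
by rewrite ler_wpM2r// psia.
Qed.

(** The first application of [F] provides the modulus of continuity; later ones commute with
    translations and contract, so [d] does not depend on [k]. *)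
Lemma iter_conv_op_equicontinuous (R : realType) (M e : R) (f psi : R -> R) :
  density f -> bmeas M psi -> 0 < e ->
  exists2 d : R, 0 < d & forall k x s, `|s| < d ->
    `|iter k.+1 (conv_op f) psi (x + s) - iter k.+1 (conv_op f) psi x| <= e.
Proof.
move=> df bpsi e0; have [If _ _] := df.
have [d d0 H] := conv_op_unif_continuous If bpsi e0.
exists d => // k x s sd; rewrite iterSr.
have bF : bmeas M (conv_op f psi) := bmeas_iter 1 df bpsi.
have bs := bmeas_shift s bF; have bN := bmeasN bF.
have bD : bmeas e (fun x => conv_op f psi (x + s) - conv_op f psi x).
  by split; [case: (bmeasD bs bN)|move=> y; exact: H].
have [_ /(_ x)] := bmeas_iter k df bD.
by rewrite (iter_conv_opD _ df bs bN) iter_conv_op_shift (iter_conv_opN _ df bF).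
Qed.

(** Asymptotic invariance handles the finitely many shifts on a grid of step [d / 2]; equicontinuity
    handles the rest of [[0, theta]]. *)
Lemma iter_conv_op_flat (R : realType) (M e theta : R) (f psi : R -> R) :
  density f -> bmeas M psi -> 0 < e -> 0 < theta ->
  exists k, forall j, (k <= j)%N -> forall x t, 0 <= t <= theta ->
    `|iter j (conv_op f) psi (x + t) - iter j (conv_op f) psi x| <= e.
Proof.
move=> df bpsi e0 th0; have e20 : 0 < e / 2 by rewrite divr_gt0.
have [d d0 Hd] := iter_conv_op_equicontinuous df bpsi e20.
have grid (n : nat) : exists k, forall j, (k <= j)%N -> forall i : nat,
    (i <= n)%N -> forall x,
    `|iter j (conv_op f) psi (x + i%:R * (d / 2)) -
      iter j (conv_op f) psi x| <= e / 2.
  elim: n => [|n [k IH]].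
    exists 0%N => j _ i; rewrite leqn0 => /eqP-> x.
    by rewrite mul0r addr0 subrr normr0 ltW.
  have [k' Hk'] := iter_conv_op_shift_cvg (n.+1%:R * (d / 2)) df bpsi e20.
  exists (maxn k k') => j; rewrite geq_max => /andP[kj k'j] i.
  rewrite leq_eqVlt => /predU1P[->|]; first exact: Hk'.
  by rewrite ltnS; exact: IH.
have d20 : 0 < d / 2 by rewrite divr_gt0.
have [k Hk] := grid (Num.truncn (theta / (d / 2))).
(* Index 0 is excluded, as equicontinuity starts at the first iterate. *)
exists k.+1 => -[//|j]; rewrite ltnS => kj x t /andP[t0 tth].
pose i := Num.truncn (t / (d / 2)).
have /andP[it ti] : i%:R <= t / (d / 2) < i.+1%:R.
  by apply: truncn_itv; rewrite divr_ge0// ltW.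
rewrite ler_pdivlMr// in it; rewrite ltr_pdivrMr// in ti.
have iN : (i <= Num.truncn (theta / (d / 2)))%N.
  by apply: le_truncn; rewrite ler_pM2r// invr_gt0.
have H1 := Hk _ (leqW kj) i iN x.
have tid : `|t - i%:R * (d / 2)| < d.
  rewrite ger0_norm ?subr_ge0//; move: ti; rewrite -natr1 mulrDl; lra.
have := Hd j (x + i%:R * (d / 2)) _ tid.
rewrite -addrA (addrC (i%:R * _)) subrK => H2.
have -> : iter j.+1 (conv_op f) psi (x + t) - iter j.+1 (conv_op f) psi x =
 (iter j.+1 (conv_op f) psi (x + t) -
   iter j.+1 (conv_op f) psi (x + i%:R * (d / 2))) +
 (iter j.+1 (conv_op f) psi (x + i%:R * (d / 2)) -
   iter j.+1 (conv_op f) psi x).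
  by rewrite addrA subrK.
by rewrite (le_trans (ler_normD _ _))// (le_trans (lerD H2 H1))//; lra.
Qed.

(** By commutation the left term is the average of [F^j psi] over [[x, x + theta]], where [F^j psi]
    is nearly constant. *)
Lemma box_iter_conv_op (R : realType) (M e theta : R) (f psi : R -> R) :
  density f -> bmeas M psi -> 0 < e -> 0 < theta ->
  exists k, forall j, (k <= j)%N -> forall x,
    `|iter j (conv_op f) (conv_op (box theta) psi) x -
      iter j (conv_op f) psi x| <= e.
Proof.
move=> df bpsi e0 th0.
have [k Hk] := iter_conv_op_flat df bpsi e0 th0; exists k => j kj x.
rewrite -(iter_conv_op_comm _ df (integrable_box theta) bpsi).
apply: (conv_op_approx (density_box th0) (bmeas_iter j df bpsi));
  last exact: ltW.
move=> t.
rewrite /box indicE; case: (boolP (t \in _)) => [/set_mem/=|];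
  last by rewrite mulr0 eqxx.
rewrite in_itv/= => /andP[t1 t2] _; apply: Hk => //; lra.
Qed.

(** The average [A] of [psi] satisfies [|A (x - t) - A x| <= 4 M |t| / theta] as well as [<= 2 M].
    The minimum of the two, integrated against [f], vanishes as [theta] grows, by dominated
    convergence. *)
Lemma conv_op_box_approx (R : realType) (M e : R) (f psi : R -> R) :
  density f -> bmeas M psi -> 0 < e ->
  exists2 th0 : R, 0 < th0 & forall theta, th0 <= theta -> forall x,
    `|conv_op f (conv_op (box theta) psi) x - conv_op (box theta) psi x| <= e.
Proof.
move=> df bpsi e0; have [If f0 f1] := df.
have M0 := bmeas_ge0 bpsi.
have mf := integrable_measurable If.
pose m (n : nat) (t : R) : R := Num.min 1 (`|t| / n.+1%:R).
have m0 n t : 0 <= m n t by rewrite le_min ler01 divr_ge0.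
have m1 n t : m n t <= 1 by rewrite ge_min lexx.
have mm n : measurable_fun [set: R] (m n).
  apply: measurable_minr => //; exact: measurable_funM.
(* [4 * M] dominates both bounds; the added 1 allows division when [M = 0]. *)
pose C := 4 * M + 1; have C0 : 0 < C by rewrite /C; lra.
have [] := @Rintegral_cvg0 _ (fun n t => m n t * f t) f If _ _ _ (e / C).
- by move=> n; exact: measurable_funM.
- by move=> n t; rewrite normrM !ger0_norm// ler_piMl.
- move=> t; rewrite -[X in _ --> X](mul0r (f t)); apply: cvgMr_tmp.
  apply/cvgr0Pnorm_le => d d0; near=> n.
  rewrite ger0_norm// ge_min; apply/orP; right.
  rewrite ler_pdivrMr// mulrC -ler_pdivrMr//.
  apply: (@le_trans _ _ n%:R); last by rewrite ler_nat.
  by near: n; exact: nbhs_infty_ger.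
- by rewrite divr_gt0.
move=> n _ /(_ n (leqnn n))/= Hn.
have Imf : integr (fun t => m n t * f t).
  by apply: (@integrable_bmeasM _ 1) => //; split=> // t; rewrite ger0_norm.
exists n.+1%:R => // theta nth x.
have th0 : 0 < theta by rewrite (lt_le_trans _ nth).
have bA : bmeas M (conv_op (box theta) psi) := bmeas_iter 1 (density_box th0) bpsi.
have Ip := integrable_translate_reflect x bA If.
set A := conv_op (box theta) psi in bA Ip *.
have -> : A x = \int[leb]_t (A x * f t) by rewrite RintegralZl// f1 mulr1.
rewrite {1}/conv_op -RintegralB//; last exact: integrZ.
have I1 : integr (fun t => A (x - t) * f t - A x * f t) := integrB Ip (integrZ _ If).
apply: le_trans (le_normr_Rintegral measurableT I1) _.
apply: (@le_trans _ _ (\int[leb]_t (C * (m n t * f t)))).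
  apply: le_Rintegral => //; [exact: integrable_norm I1|exact: integrZ|].
  move=> t _; rewrite -mulrBl normrM (ger0_norm (f0 t)) mulrA ler_wpM2r//.
  rewrite /m; case: (leP 1 (`|t| / n.+1%:R)) => _.
    rewrite mulr1 (le_trans (ler_normB _ _))//.
    by have [_ b] := bA; have := b x; have := b (x - t); rewrite /C; lra.
  apply: le_trans (conv_op_shift_diff x (- t) (integrable_box theta) bpsi) _.
  have := ler_wpM2l M0 (box_shift_diff (- t) th0); move/le_trans; apply.
  rewrite normrN; apply: (@le_trans _ _ (M * (4 * `|t| / n.+1%:R))).
    by rewrite ler_wpM2l// ler_wpM2l ?mulr_ge0// lef_pV2// posrE.
  rewrite !mulrA ler_wpM2r// ler_wpM2r// /C; lra.
rewrite RintegralZl// mulrC -ler_pdivlMr//.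
apply: le_trans Hn; apply: le_Rintegral => //.
  exact: integrable_norm Imf.
by move=> t _; exact: ler_norm.
Unshelve. all: by end_near. Qed.

(** Induction on [F^(k+1) A - A = F^k (F A - A) + (F^k A - A)], where [F^k] contracts the first
    term. *)
Lemma iter_conv_op_box_approx (R : realType) (M e : R) (f psi : R -> R) k :
  density f -> bmeas M psi -> 0 < e ->
  exists2 th0 : R, 0 < th0 & forall theta, th0 <= theta -> forall x,
    `|iter k (conv_op f) (conv_op (box theta) psi) x -
      conv_op (box theta) psi x| <= e.
Proof.
move=> df bpsi; elim: k e => [|k IH] e e0.
  by exists 1 => // theta _ x; rewrite subrr normr0 ltW.
have e20 : 0 < e / 2 by rewrite divr_gt0.
have [th1 th10 H1] := IH _ e20.
have [th2 th20 H2] := conv_op_box_approx df bpsi e20.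
exists (Num.max th1 th2) => [|theta]; first by rewrite lt_max th10.
rewrite ge_max => /andP[th1t th2t] x.
have th0 : 0 < theta by rewrite (lt_le_trans th10).
have bA : bmeas M (conv_op (box theta) psi) := bmeas_iter 1 (density_box th0) bpsi.
have bFA : bmeas M (conv_op f (conv_op (box theta) psi)) := bmeas_iter 1 df bA.
set A := conv_op (box theta) psi in bA bFA *.
have bN := bmeasN bA.
have bD : bmeas (e / 2) (fun x => conv_op f A x - A x).
  by split; [case: (bmeasD bFA bN)|move=> y; exact: H2].
have [_ /(_ x)] := bmeas_iter k df bD.
rewrite (iter_conv_opD _ df bFA bN) (iter_conv_opN _ df bA) iterSr => H3.
have H4 := H1 theta th1t x; rewrite -/A in H4.
set p := iter k _ (conv_op f A) x in H3 *.
set q := iter k _ A x in H3 H4 *; set r := A x in H4 *.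
have -> : p - r = (p - q) + (q - r) by lra.
by rewrite (le_trans (ler_normD _ _))// (le_trans (lerD H3 H4))//; lra.
Qed.

(** For [x >= X + n], only the mass of [f] beyond [n] meets values of [psi] left of [X], and this
    mass is small. *)
Lemma conv_op_eventually_le (R : realType) (M L e X : R) (f psi : R -> R) :
  density f -> bmeas M psi -> (forall x, X <= x -> psi x <= L) -> 0 < e ->
  exists Y : R, forall x, Y <= x -> conv_op f psi x <= L + e.
Proof.
move=> df bpsi psiL e0; have [If f0 f1] := df.
have mf := integrable_measurable If.
pose T (n : nat) (t : R) : R := \1_(`]n%:R, +oo[%classic : set R) t.
have mT n : measurable_fun [set: R] (T n).
  by apply: measurable_indic; exact: measurable_itv.
have T0 n t : 0 <= T n t by [].
have T1 n t : T n t <= 1 by rewrite /T indicE lern1 leq_b1.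
(* Chosen so that [M <= L + C], which bounds [psi] on the tail, and so that [C > 0]. *)
pose C := M + `|L| + 1.
have M0 := bmeas_ge0 bpsi.
have C0 : 0 < C by rewrite /C; have := normr_ge0 L; lra.
have [] := @Rintegral_cvg0 _ (fun n t => T n t * f t) f If _ _ _ (e / C).
- by move=> n; exact: measurable_funM.
- by move=> n t; rewrite normrM !ger0_norm// ler_piMl.
- move=> t; apply/cvgr0Pnorm_le => d d0; near=> n.
  rewrite /T indicE memNset ?mul0r ?normr0 ?ltW//= in_itv/= andbT.
  apply/negP; rewrite -leNgt; near: n; exact: nbhs_infty_ger.
- by rewrite divr_gt0.
move=> n _ /(_ n (leqnn n))/= Hn.
have ITf : integr (fun t => T n t * f t).
  by apply: (@integrable_bmeasM _ 1) => //; split=> // t; rewrite ger0_norm.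
exists (X + n%:R) => x Xx.
have Ip := integrable_translate_reflect x bpsi If.
apply: (@le_trans _ _ (\int[leb]_t (L * f t + C * (T n t * f t)))).
  apply: le_Rintegral => //; first exact: integrD (integrZ _ If) (integrZ _ ITf).
  move=> t _; rewrite mulrA -mulrDl ler_wpM2r// /T indicE.
  case: (boolP (t \in _)) => [_|].
    have [_ /(_ (x - t))] := bpsi; rewrite mulr1 /C.
    have := ler_norm (psi (x - t)); have := ler_norm (- L); rewrite normrN; lra.
  move=> tn; rewrite mulr0 addr0; apply: psiL.
  suff : t <= n%:R by move: Xx; lra.
  rewrite leNgt; apply: contra tn => tn; apply/mem_set => /=.
  by rewrite in_itv/= tn.
rewrite RintegralD//; [|exact: integrZ|exact: integrZ].
rewrite !RintegralZl// f1 mulr1 lerD2l mulrC -ler_pdivlMr//.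
apply: le_trans Hn; apply: le_Rintegral => //; first exact: integrable_norm ITf.
by move=> t _; exact: ler_norm.
Unshelve. all: by end_near. Qed.

(** * Upper limits *)

Lemma leb_ae_mono (R : realType) (P Q : R -> Prop) :
  (forall x, P x -> Q x) ->
  {ae @leb R, forall x, P x} -> {ae @leb R, forall x, Q x}.
Proof.
move=> PQ [N [mN N0 PN]]; exists N; split=> // x nQ.
by apply: PN => /PQ.
Qed.

(** A real number, for the sake of linear arithmetic; by [rlimsupE] it is the true upper limit when
    [g] is bounded. *)
Definition rlimsup (R : realType) (g : R -> R) : R :=
  fine (limf_esup (fun x : R => (g x)%:E) (pinfty_nbhs R)).

Lemma limf_esup_pinfty_le (R : realType) (L X : R) (g : R -> R) :
  (forall x, X <= x -> g x <= L) ->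
  (limf_esup (fun x : R => (g x)%:E) (pinfty_nbhs R) <= L%:E)%E.
Proof.
move=> gL; apply: (@le_trans _ _
  (ereal_sup ((fun x : R => (g x)%:E) @` [set x | X <= x]))).
  apply: ereal_inf_lbound; exists [set x | X <= x] => //.
  by exists X; split; [exact: num_real|move=> x; exact: ltW].
by apply: ge_ereal_sup => _ [x Xx <-]; rewrite lee_fin gL.
Qed.

Lemma limf_esup_pinfty_ge (R : realType) (L : R) (g : R -> R) :
  (forall x, L <= g x) ->
  (L%:E <= limf_esup (fun x : R => (g x)%:E) (pinfty_nbhs R))%E.
Proof.
move=> Lg; apply: le_ereal_inf_tmp => _ [V [A [_ AV]] <-].
apply: (@le_trans _ _ (g (A + 1))%:E); first by rewrite lee_fin.
by apply: ereal_sup_ubound; exists (A + 1) => //; apply: AV; rewrite ltrDl.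
Qed.

Lemma rlimsupE (R : realType) (M : R) (g : R -> R) : (forall x, `|g x| <= M) ->
  limf_esup (fun x : R => (g x)%:E) (pinfty_nbhs R) = (rlimsup g)%:E.
Proof.
move=> gM; rewrite fineK// fin_numElt; apply/andP; split.
  apply: (@lt_le_trans _ _ (- M)%:E); first exact: ltNyr.
  apply: limf_esup_pinfty_ge => x.
  by have := gM x; rewrite ler_norml => /andP[].
apply: (@le_lt_trans _ _ M%:E); last exact: ltry.
apply: (@limf_esup_pinfty_le _ _ 0) => x _.
by rewrite (le_trans (ler_norm _)).
Qed.

Lemma rlimsup_le (R : realType) (M L X : R) (g : R -> R) :
  (forall x, `|g x| <= M) -> (forall x, X <= x -> g x <= L) -> rlimsup g <= L.
Proof.
by move=> gM gL; rewrite -lee_fin -(rlimsupE gM); exact: limf_esup_pinfty_le gL.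
Qed.

Lemma rlimsup_lt (R : realType) (M l : R) (g : R -> R) :
  (forall x, `|g x| <= M) -> rlimsup g < l ->
  exists X, forall x, X <= x -> g x <= l.
Proof.
move=> gM; rewrite -lte_fin -(rlimsupE gM) => /ereal_inf_lt[_ [V [A [_ AV]] <-]] Vl.
exists (A + 1) => x Ax; rewrite -lee_fin (le_trans _ (ltW Vl))//.
by apply: ereal_sup_ubound; exists x => //; apply: AV; rewrite (lt_le_trans _ Ax)// ltrDl.
Qed.

Lemma rlimsup_leD (R : realType) (M e : R) (u v : R -> R) :
  (forall x, `|u x| <= M) -> (forall x, `|v x| <= M) ->
  (forall x, u x <= v x + e) -> rlimsup u <= rlimsup v + e.
Proof.
move=> uM vM uv; apply/ler_addgt0Pr => d d0.
have [X vX] : exists X, forall x, X <= x -> v x <= rlimsup v + d.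
  by apply: (rlimsup_lt vM); rewrite ltrDl.
apply: (rlimsup_le uM (X := X)) => x Xx.
by rewrite (le_trans (uv x))// addrAC lerD2r vX.
Qed.

(** Applied to [f] it gives monotonicity in [k]; applied to [box theta] it bounds averages of
    iterates. *)
Lemma rlimsup_conv_op (R : realType) (M : R) (f psi : R -> R) :
  density f -> bmeas M psi -> rlimsup (conv_op f psi) <= rlimsup psi.
Proof.
move=> df bpsi; have [_ bF] := bmeas_iter 1 df bpsi.
apply/ler_addgt0Pr => e e0; have e20 : 0 < e / 2 by rewrite divr_gt0.
have [X vX] : exists X, forall x, X <= x -> psi x <= rlimsup psi + e / 2.
  by case: bpsi => _ b; apply: (rlimsup_lt b); rewrite ltrDl.
have [Y H] := conv_op_eventually_le df bpsi vX e20.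
by apply: (rlimsup_le bF (X := Y)) => x /H; rewrite /=; lra.
Qed.

Lemma rlimsup_iter_conv_op (R : realType) (M : R) (f psi : R -> R) k :
  density f -> bmeas M psi -> rlimsup (iter k (conv_op f) psi) <= rlimsup psi.
Proof.
move=> df bpsi; elim: k => // k; apply: le_trans.
exact: rlimsup_conv_op df (bmeas_iter k df bpsi).
Qed.

(** [F^k psi] is uniformly within [e] of [F^k A_theta psi], whose upper limit is at most that of
    [A_theta psi]. *)
Lemma rlimsup_iter_le_box (R : realType) (M e theta : R) (f psi : R -> R) :
  density f -> bmeas M psi -> 0 < e -> 0 < theta ->
  exists k, rlimsup (iter k (conv_op f) psi) <=
    rlimsup (conv_op (box theta) psi) + e.
Proof.
move=> df bpsi e0 th0; have [k Hk] := box_iter_conv_op df bpsi e0 th0.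
have bA : bmeas M (conv_op (box theta) psi) := bmeas_iter 1 (density_box th0) bpsi.
have [_ b1] := bmeas_iter k df bpsi; have [_ b2] := bmeas_iter k df bA.
exists k; have := rlimsup_iter_conv_op k df bA; rewrite -(lerD2r e); apply: le_trans.
apply: (rlimsup_leD b1 b2) => x.
by have := Hk k (leqnn k) x; rewrite ler_norml => /andP[]; lra.
Qed.

(** [A_theta psi] is uniformly within [e] of [F^k A_theta psi = A_theta F^k psi], whose upper limit
    is at most that of [F^k psi]. *)
Lemma rlimsup_box_le_iter (R : realType) (M e : R) (f psi : R -> R) k :
  density f -> bmeas M psi -> 0 < e ->
  exists2 th0 : R, 0 < th0 & forall theta, th0 <= theta ->
    rlimsup (conv_op (box theta) psi) <= rlimsup (iter k (conv_op f) psi) + e.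
Proof.
move=> df bpsi e0; have [th0 th00 H] := iter_conv_op_box_approx k df bpsi e0.
exists th0 => // theta tht; have t0 : 0 < theta by rewrite (lt_le_trans th00).
have bA : bmeas M (conv_op (box theta) psi) := bmeas_iter 1 (density_box t0) bpsi.
have bF := bmeas_iter k df bpsi; have bFA := bmeas_iter k df bA.
have := rlimsup_conv_op (density_box t0) bF; rewrite -(lerD2r e); apply: le_trans.
rewrite (iter_conv_op_comm _ df (integrable_box theta) bpsi).
case: bA => _ b1; case: bFA => _ b2; apply: (rlimsup_leD b1 b2) => x.
by have := H theta tht x; rewrite ler_norml => /andP[]; lra.
Qed.

(** The common limit is the infimum over [k]. It lies below the value at every [theta > 0], and any
    term of the sequence nearly bounds the values at large [theta]. *)
Lemma rlimsup_cvg (R : realType) (M : R) (f psi : R -> R) :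
  density f -> bmeas M psi -> exists l : R,
    rlimsup (iter k (conv_op f) psi) @[k --> \oo] --> l /\
    rlimsup (conv_op (box theta) psi) @[theta --> pinfty_nbhs R] --> l.
Proof.
move=> df bpsi; pose a k := rlimsup (iter k (conv_op f) psi).
have a_dec : nonincreasing_seq a.
  apply/nonincreasing_seqP => k.
  exact: rlimsup_conv_op df (bmeas_iter k df bpsi).
have a_lb : has_lbound (range a).
  exists (- M) => _ [k _ <-]; rewrite -lee_fin.
  have [_ b] := bmeas_iter k df bpsi; rewrite /a -(rlimsupE b).
  apply: limf_esup_pinfty_ge => x.
  by have := b x; rewrite ler_norml => /andP[].
have acvg := nonincreasing_cvgn a_dec a_lb.
exists (inf (range a)); split; first exact: acvg.
apply/cvgrPdist_le => e e0; have e20 : 0 < e / 2 by rewrite divr_gt0.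
have [_ [k _ <-] ak] : exists2 y, range a y & y < inf (range a) + e / 2.
  by apply: inf_adherent => //; split=> //; exists (a 0%N), 0%N.
have [th0 th00 H] := rlimsup_box_le_iter k df bpsi e20.
exists th0; split; first exact: num_real.
move=> theta tht; have t0 : 0 < theta by rewrite (lt_trans th00).
have h1 := H theta (ltW tht).
have h2 : inf (range a) <= rlimsup (conv_op (box theta) psi).
  apply/ler_addgt0Pr => d d0; have [j Hj] := rlimsup_iter_le_box df bpsi d0 t0.
  by apply: le_trans Hj; apply: ge_inf => //; exists j.
by rewrite ler0_norm ?subr_le0// opprB; rewrite -/(a k) in h1; lra.
Qed.

(** * Reduction to densities and bounded representatives *)

(** The positive part of [f] equals [f] almost everywhere, so every convolution integral is
    unchanged. *)
Lemma Lflat_density (R : realType) (f : R -> R) : Lflat f ->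
  exists2 f' : R -> R, density f' & forall psi, measurable_fun [set: R] psi ->
    conv_op f psi = conv_op f' psi.
Proof.
move=> [/Lfun1_integrable If f0 f1]; exists (fun x => Num.max (f x) 0).
  have mf := integrable_measurable If.
  have mf' : measurable_fun [set: R] (fun x => Num.max (f x) 0).
    exact: measurable_maxr.
  split.
  - apply: (le_integrable measurableT _ _ (integrable_norm If)).
      exact/measurable_EFinP.
    move=> x _ /=; rewrite lee_fin normr_id.
    by case: (leP (f x) 0) => _; rewrite ?normr0.
  - by move=> x; rewrite le_max lexx orbT.
  have <- : \int[leb]_x f x = 1.
    (* The real part of the transform at 0 is the integral of [f]. *)
    move: f1 => /eqP; rewrite eq_complex/= => /andP[/eqP + _] => <-.
    by congr fine; apply: eq_integral => x _; rewrite mul0r cos0 mulr1.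
  congr fine; apply: ae_eq_integral => //;
    [exact/measurable_EFinP|exact/measurable_EFinP|].
  by apply: leb_ae_mono f0 => x fx _ /=; rewrite max_l.
move=> psi mpsi; apply/funext => x.
have mf := integrable_measurable If.
have mf' : measurable_fun [set: R] (fun x => Num.max (f x) 0).
  exact: measurable_maxr.
have mpx : measurable_fun [set: R] (fun t => psi (x - t)).
  by apply: measurableT_comp => //; exact: measurable_funB.
congr fine; apply: ae_eq_integral => //;
  [by apply/measurable_EFinP; exact: measurable_funM..|].
by apply: leb_ae_mono f0 => t ft _ /=; rewrite max_l.
Qed.

Lemma Linfty_bmeas (R : realType) (phi : R -> R) : Linfty phi ->
  measurable_fun [set: R] phi /\
  exists M, exists2 psi, bmeas M psi & {ae @leb R, forall x, phi x = psi x}.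
Proof.
rewrite /Linfty => /andP[]; rewrite !inE/= => mphi; rewrite /finite_norm unlock.
(* The L^oo norm is unfolded to an essential supremum once the line is known to have positive
   measure. *)
have leb0 : (0 < @leb R setT)%E.
  by rewrite -set_itvNyy lebesgue_measure_itv/= addye ?ltry.
rewrite leb0 => /ess_supr_bounded[M phiM]; split=> //.
(* Truncation at the essential bound alters [phi] only on a null set. *)
exists `|M|, (fun x => Num.max (- `|M|) (Num.min `|M| (phi x))).
  split.
    by apply: measurable_maxr => //; exact: measurable_minr.
  move=> x; rewrite ler_norml le_max lexx/= ge_max ge_min lexx/= andbT.
  by rewrite ge0_cp.
apply: leb_ae_mono phiM => x /= xM.
have : `|phi x| <= `|M| by rewrite (le_trans xM)// ler_norm.
by rewrite ler_norml => /andP[h1 h2]; rewrite min_r// max_r.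
Qed.

(** The reflection [t -> x - t] preserves null sets, so the integrands agree almost everywhere for
    each [x]. *)
Lemma conv_op_ae (R : realType) (f u v : R -> R) :
  measurable_fun [set: R] f -> measurable_fun [set: R] u ->
  measurable_fun [set: R] v -> {ae @leb R, forall x, u x = v x} ->
  conv_op f u = conv_op f v.
Proof.
move=> mf mu mv uv; apply/funext => x.
have mx (w : R -> R) : measurable_fun [set: R] w ->
    measurable_fun [set: R] (fun t => w (x - t) * f t).
  move=> mw; apply: measurable_funM => //; apply: measurableT_comp => //.
  exact: measurable_funB.
congr fine; apply: ae_eq_integral => //;
  [by apply/measurable_EFinP; exact: mx..|].
have := leb_preserving_ae (leb_preserving_reflect x) uv.
by apply: leb_ae_mono => t /= -> _.
Qed.

(* The two [cvg] conjuncts say that the limits in [Fbar_infty] and [Pbar] exist. *)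
Theorem theorem4p2 (R : realType) (f : R -> R) (hf : Lflat f)
    (phi : R -> R) (hphi : Linfty phi) :
  [/\ cvg (Fbar f phi k @[k --> \oo]),
      cvg (Pbar_at phi theta @[theta --> pinfty_nbhs R]) &
      Fbar_infty f phi = Pbar phi].
Proof.
have [g dg fg] := Lflat_density hf.
have [mphi [M [psi bpsi phipsi]]] := Linfty_bmeas hphi.
have [Ig _ _] := dg; have mg := integrable_measurable Ig.
have mpsi : measurable_fun [set: R] psi by case: bpsi.
(* One convolution turns almost everywhere equality into equality; at index 0 [phi] and [psi] may
   differ on a null set. *)
have iterE k : iter k.+1 (conv_op f) phi = iter k.+1 (conv_op g) psi.
  elim: k => [|k IH].
    by rewrite /= fg// (conv_op_ae mg mphi mpsi phipsi).
  rewrite iterS IH fg//.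
  by case: (bmeas_iter k.+1 dg bpsi).
have FE k : Fbar f phi k.+1 = (rlimsup (iter k.+1 (conv_op g) psi))%:E.
  rewrite /Fbar iterE; apply: (@rlimsupE _ M).
  by case: (bmeas_iter k.+1 dg bpsi).
have PE theta : 0 < theta ->
    Pbar_at phi theta = (rlimsup (conv_op (box theta) psi))%:E.
  move=> th0; rewrite -(@rlimsupE _ M); last first.
    by case: (bmeas_iter 1 (density_box th0) bpsi).
  congr limf_esup; apply/funext => x; rewrite (conv_op_boxE x th0 bpsi).
  congr (_ * _)%:E; congr fine; apply: ae_eq_integral => //.
  - by apply/measurable_EFinP; exact: measurable_funTS.
  - by apply/measurable_EFinP; exact: measurable_funTS.
  - by apply: leb_ae_mono phipsi => t /= -> _.
have [l [al pl]] := rlimsup_cvg dg bpsi.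
have Fl : Fbar f phi k @[k --> \oo] --> l%:E.
  rewrite -cvg_shiftS; under eq_fun do rewrite FE.
  by apply: cvg_EFin; [exact: nearW|move: al; rewrite -cvg_shiftS].
have Pl : Pbar_at phi theta @[theta --> pinfty_nbhs R] --> l%:E.
  have : (rlimsup (conv_op (box theta) psi))%:E @[theta --> pinfty_nbhs R] --> l%:E.
    by apply: cvg_EFin; [exact: nearW|exact: pl].
  (* The two functions of [theta] are identified only for [theta > 0], which suffices near
     infinity. *)
  apply: cvg_trans; apply: near_eq_cvg.
  by exists 0; split=> // theta /PE.
split; [exact: (cvgP _ Fl)|exact: (cvgP _ Pl)|].
by rewrite /Fbar_infty /Pbar (cvg_lim _ Fl)// (cvg_lim _ Pl).
Qed.
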